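(* Let $n\ge 2$, let $k$ be a field of characteristic zero, let $R=k[[x_1,\ldots,x_n]]$, and let $f\in R$ define an isolated hypersurface singularity $R/\langle f\rangle$ (at the null point). Assume that $f$ is not quasihomogeneous. Then: (i) If $\mu_f-\tau_f\le 2$, then $e^{\mathrm{BS}}(f)=2$. (ii) If $\mu_f-\tau_f\le e^{\mathrm{BS}}(f)-1$, then $e^{\mathrm{BS}}(f)=2$. (iii) If $\mu_f-\tau_f=3$, then $e^{\mathrm{BS}}(f)\le 3$ and either $(\beta_f,\tau_f)=(1,2)$ or else $\beta_f=0$. (iv) If $\mu_f-\tau_f=4$, then $e^{\mathrm{BS}}(f)\le 3$ and either $(\beta_f,e^{\mathrm{BS}}(f),\tau_f)=(1,3,3)$ or $(\beta_f,e^{\mathrm{BS}}(f),\tau_f)=(1,3,2)$, or else $\beta_f=0$.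
   Context: Write $J_f=\langle \partial f/\partial x_1,\ldots,\partial f/\partial x_n\rangle\subset R$ and $I_f=\langle f, J_f\rangle\subset R$. That $f$ defines an isolated hypersurface singularity (at the null point) means that $f$ and all $\partial f/\partial x_i$ lie in the maximal ideal $\langle x_1,\ldots,x_n\rangle$ of $R$ and that $J_f$ and $I_f$ are primary to this maximal ideal. The Milnor number is $\mu_f=\dim_k R/J_f$ and the Tjurina number is $\tau_f=\dim_k R/I_f$. $f$ is called quasihomogeneous if $f\in J_f$ (equivalently, $I_f=J_f$). The Briançon–Skoda exponent of $f$ is $e^{\mathrm{BS}}(f)=\min\{d\in\mathbb{N} : f^d\in J_f\}$; by the Briançon–Skoda theorem $e^{\mathrm{BS}}(f)\le n$. The Milnor–Tjurina ratio of $f$ is $\beta_f=\max\{i\ge 0 : \langle J_f:f^i,\, f\rangle\subseteq I_f\}$, where $\langle J_f:f^i,\,f\rangle$ is the ideal generated by the colon ideal $J_f:f^i$ and $f$ (for $i=0$ this ideal equals $I_f$). *)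

(* Defs.v *)
From HB Require Import structures.
From mathcomp Require Import all_boot all_order all_algebra.
From mathcomp Require Import mpoly.
From mathcomp Require Import boolp classical_sets.

Set Implicit Arguments.
Unset Strict Implicit.
Unset Printing Implicit Defensive.

Import GRing.Theory.

Local Open Scope ring_scope.
Local Open Scope classical_set_scope.

(* R[[x_1, ..., x_n]]; the exponent vectors are the monomials 'X_{1..n} of the
   multivariate polynomial library. *)
Record mpseries (n : nat) (R : Type) :=
  MPSeries { mpscoef : 'X_{1..n} -> R }.

Notation "{ 'mpseries' R [ n ] }" := (mpseries n R)
  (at level 0, R, n at level 2, format "{ 'mpseries'  R [ n ] }") : type_scope.

HB.instance Definition _ n R := gen_eqMixin (mpseries n R).
HB.instance Definition _ n R := gen_choiceMixin (mpseries n R).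

Lemma mpseriesP n R (f g : mpseries n R) : mpscoef f =1 mpscoef g -> f = g.
Proof. by case: f g => [f] [g] /= /funext ->. Qed.

Section PowerSeriesRing.
Variables (n : nat) (R : comNzRingType).
Implicit Types (f g h : {mpseries R[n]}) (m : 'X_{1..n}) (c : R).

Definition mps_zero : {mpseries R[n]} := MPSeries (fun=> 0).
Definition mps_add f g : {mpseries R[n]} :=
  MPSeries (fun m => mpscoef f m + mpscoef g m).
Definition mps_opp f : {mpseries R[n]} := MPSeries (fun m => - mpscoef f m).
Definition mps_one : {mpseries R[n]} := MPSeries (fun m => (m == 0%MM)%:R).
Definition mps_scale c f : {mpseries R[n]} :=
  MPSeries (fun m => c * mpscoef f m).

(* Cauchy product; the bound on the degrees only makes the index set of the sum
   over all k.1 + k.2 = m a finite type. *)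
Definition mps_mul f g : {mpseries R[n]} :=
  MPSeries (fun m =>
    \sum_(k : 'X_{1..n < (mdeg m).+1, (mdeg m).+1} | m == (k.1 + k.2)%MM)
       mpscoef f k.1 * mpscoef g k.2).

Lemma mps_addA : associative mps_add.
Proof. by move=> f g h; apply: mpseriesP => m /=; rewrite addrA. Qed.
Lemma mps_addC : commutative mps_add.
Proof. by move=> f g; apply: mpseriesP => m /=; rewrite addrC. Qed.
Lemma mps_add0 : left_id mps_zero mps_add.
Proof. by move=> f; apply: mpseriesP => m /=; rewrite add0r. Qed.
Lemma mps_addN : left_inverse mps_zero mps_opp mps_add.
Proof. by move=> f; apply: mpseriesP => m /=; rewrite addNr. Qed.

HB.instance Definition _ := GRing.isZmodule.Build {mpseries R[n]}
  mps_addA mps_addC mps_add0 mps_addN.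

Definition mps_trunc d f : {mpoly R[n]} :=
  \sum_(m : 'X_{1..n < d}) mpscoef f m *: 'X_[m].

Lemma mcoeff_trunc d f m : (mdeg m < d)%N -> (mps_trunc d f)@_m = mpscoef f m.
Proof. exact: mcoeff_mpoly. Qed.

Lemma mps_mul_eq f g (p q : {mpoly R[n]}) m :
    (forall m', (mdeg m' <= mdeg m)%N -> p@_m' = mpscoef f m') ->
    (forall m', (mdeg m' <= mdeg m)%N -> q@_m' = mpscoef g m') ->
  mpscoef (mps_mul f g) m = (p * q)@_m.
Proof.
move=> pf qg; rewrite mcoeffM /=; apply: eq_bigr => -[k1 k2] _ /=.
by rewrite pf ?qg // -ltnS bmdeg.
Qed.

Lemma mps_mul_trunc d f g m : (mdeg m < d)%N ->
  mpscoef (mps_mul f g) m = (mps_trunc d f * mps_trunc d g)@_m.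
Proof.
by move=> lt_md; apply: mps_mul_eq => m' le_m'm;
  rewrite mcoeff_trunc // (leq_ltn_trans le_m'm).
Qed.

Lemma mps_mulA : associative mps_mul.
Proof.
move=> f g h; apply: mpseriesP => m; set d := (mdeg m).+1.
have trE f' m' : (mdeg m' <= mdeg m)%N -> (mps_trunc d f')@_m' = mpscoef f' m'.
  by move=> ?; rewrite mcoeff_trunc.
rewrite (@mps_mul_eq _ _ (mps_trunc d f) (mps_trunc d g * mps_trunc d h)) //;
  try exact: trE; last by move=> m' ?; rewrite (@mps_mul_trunc d).
rewrite (@mps_mul_eq _ _ (mps_trunc d f * mps_trunc d g) (mps_trunc d h)) //;
  try exact: trE; last by move=> m' ?; rewrite (@mps_mul_trunc d).
by rewrite mulrA.
Qed.

Lemma mps_mulC : commutative mps_mul.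
Proof.
move=> f g; apply: mpseriesP => m.
by rewrite !(@mps_mul_trunc (mdeg m).+1) // mulrC.
Qed.

Lemma mps_mul1 : left_id mps_one mps_mul.
Proof.
move=> f; apply: mpseriesP => m.
rewrite (@mps_mul_eq _ _ 1 (mps_trunc (mdeg m).+1 f)).
- by rewrite mul1r mcoeff_trunc.
- by move=> m' _; rewrite mcoeff1.
- by move=> m' ?; rewrite mcoeff_trunc.
Qed.

Lemma mps_mulDl : left_distributive mps_mul mps_add.
Proof.
move=> f g h; apply: mpseriesP => m /=; rewrite -big_split /=.
by apply: eq_bigr => k _; rewrite mulrDl.
Qed.

Lemma mps_oner_neq0 : mps_one != mps_zero.
Proof.
apply/eqP => /(congr1 (fun f : {mpseries R[n]} => mpscoef f 0%MM)) /=.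
by move/eqP; rewrite eqxx oner_eq0.
Qed.

HB.instance Definition _ := GRing.Zmodule_isComNzRing.Build {mpseries R[n]}
  mps_mulA mps_mulC mps_mul1 mps_mulDl mps_oner_neq0.

Lemma mps_scaleA a b f : mps_scale a (mps_scale b f) = mps_scale (a * b) f.
Proof. by apply: mpseriesP => m /=; rewrite mulrA. Qed.
Lemma mps_scale1 : left_id 1 mps_scale.
Proof. by move=> f; apply: mpseriesP => m /=; rewrite mul1r. Qed.
Lemma mps_scaleDr : right_distributive mps_scale +%R.
Proof. by move=> c f g; apply: mpseriesP => m /=; rewrite mulrDr. Qed.
Lemma mps_scaleDl f : {morph mps_scale^~ f : a b / a + b}.
Proof. by move=> a b; apply: mpseriesP => m /=; rewrite mulrDl. Qed.

HB.instance Definition _ := GRing.Zmodule_isLmodule.Build R {mpseries R[n]}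
  mps_scaleA mps_scale1 mps_scaleDr mps_scaleDl.

Lemma mps_scaleAl c f g : c *: (f * g) = c *: f * g.
Proof.
apply: mpseriesP => m /=; rewrite mulr_sumr.
by apply: eq_bigr => k _; rewrite mulrA.
Qed.

HB.instance Definition _ :=
  GRing.Lmodule_isLalgebra.Build R {mpseries R[n]} mps_scaleAl.
HB.instance Definition _ := GRing.Lalgebra_isComAlgebra.Build R {mpseries R[n]}.

Definition mpsX (i : 'I_n) : {mpseries R[n]} :=
  MPSeries (fun m => (m == U_(i)%MM)%:R).

Definition mpsderiv (i : 'I_n) f : {mpseries R[n]} :=
  MPSeries (fun m => mpscoef f (m + U_(i))%MM *+ (m i).+1).

End PowerSeriesRing.

Arguments mpsX {n R} i.

Section Ideals.
Variable A : comNzRingType.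
Implicit Types (I J S : set A) (a b x y : A).

(* The ideals of the library (ring_quotient) are proper by definition, whereas
   a colon ideal may be the whole ring. *)
Definition is_ideal I : Prop :=
  I 0 /\ forall a x y, I x -> I y -> I (a * x + y).

Definition ideal_gen S : set A :=
  [set x | forall I, is_ideal I -> S `<=` I -> I x].

Definition colon_ideal J a : set A := [set x | J (x * a)].

Definition ideal_radical I : set A := [set x | exists d : nat, I (x ^+ d)].

Definition primary_ideal I : Prop :=
  [/\ is_ideal I, ~ I 1
    & forall a b, I (a * b) -> I a \/ exists d : nat, I (b ^+ d)].

Definition primary_to I J : Prop := primary_ideal I /\ ideal_radical I = J.

End Ideals.

Section Numbers.
Implicit Type P : set nat.

(* Both are 0 when the minimum, resp. the maximum, does not exist. *)
Definition nat_min P : nat :=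
  xget 0%N [set d | P d /\ forall e, P e -> (d <= e)%N].

Definition nat_max P : nat :=
  xget 0%N [set d | P d /\ forall e, P e -> (e <= d)%N].

End Numbers.

Section QuotientDimension.
Variables (k : fieldType) (V : lmodType k).

(* The residue classes of b 0, ..., b (d - 1) form a k-basis of V / W. *)
Definition quot_basis (W : set V) (d : nat) (b : 'I_d -> V) : Prop :=
  forall v : V, exists! c : 'rV[k]_d, W (v - \sum_(i < d) c 0 i *: b i).

(* dim_k (V / W) for a subspace W; 0 when this dimension is infinite. *)
Definition quot_dim (W : set V) : nat :=
  xget 0%N [set d | exists b : 'I_d -> V, quot_basis W b].

End QuotientDimension.

Section Singularities.
Variables (n : nat) (k : fieldType).
Implicit Type f : {mpseries k[n]}.

Definition max_ideal : set {mpseries k[n]} :=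
  ideal_gen (range (fun i : 'I_n => mpsX i)).

Definition jacobian_ideal f : set {mpseries k[n]} :=
  ideal_gen (range (fun i : 'I_n => mpsderiv i f)).

Definition tjurina_ideal f : set {mpseries k[n]} :=
  ideal_gen ([set f] `|` jacobian_ideal f).

Definition isolated_singularity f : Prop :=
  [/\ max_ideal f,
      forall i : 'I_n, max_ideal (mpsderiv i f),
      primary_to (jacobian_ideal f) max_ideal
    & primary_to (tjurina_ideal f) max_ideal].

Definition milnor_number f : nat := quot_dim (jacobian_ideal f).

Definition tjurina_number f : nat := quot_dim (tjurina_ideal f).

Definition quasihomogeneous f : Prop := jacobian_ideal f f.

Definition bs_exponent f : nat :=
  nat_min [set d | jacobian_ideal f (f ^+ d)].

Definition mt_ratio f : nat :=
  nat_max [set i | ideal_gen (colon_ideal (jacobian_ideal f) (f ^+ i) `|` [set f])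
                     `<=` tjurina_ideal f].

End Singularities.

(* Main.v *)
(* Let J = J_f and let m be the maximal ideal.  Multiplication by f gives
   dim R/J = dim R/(J + (f)) + dim R/(J : f), so mu - tau = dim R/(J : f), and
   likewise dim R/(J : f^i) - dim R/(J : f^(i+1)) = dim R/((J : f^i) + (f)).
   Euler's identity for the quadratic part gives f in J + m^3, so by Nakayama the
   latter dimension is at least 2 when f^(i+1) is not in J.  Hence
   mu - tau >= 2 e - 3, which yields all the bounds on e.

   If beta > 0 then J : f is contained in J + (f), so tau <= mu - tau <= 4, and this
   is contradictory: beta = 0 in (iii) and (iv).  Indeed J + (f) lies in J + m^3, and
   m/(J + m^2) has dimension at least 2, since f would otherwise belong to J (an
   A_k singularity).  So J + m^3 has codimension at most one in J + m^2, whence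
   m^d lies in J + (l^d) for some l in m and d = 2, 3.  Then f = b l^3 modulo J,
   and x_i l = c_i l^2 modulo J gives x_i - c_i l in J : f, hence in J + m^2: the
   dimension of m/(J + m^2) would be at most 1. *)

Require Import Defs.
From mathcomp Require Import all_boot all_order all_algebra.
From mathcomp Require Import mpoly.
From mathcomp Require Import boolp classical_sets.
From mathcomp Require Import ring zify.

Set Implicit Arguments.
Unset Strict Implicit.
Unset Printing Implicit Defensive.

Import GRing.Theory.

Local Open Scope ring_scope.

(** * Dimensions of quotient spaces *)

Section QuotientDimensionTheory.
Local Open Scope classical_set_scope.
Variables (k : fieldType) (V : lmodType k).
Implicit Types W : set V.

Definition is_subspace W : Prop :=
  W 0 /\ forall (a : k) x y, W x -> W y -> W (a *: x + y).

Definition quot_spans W d (b : 'I_d -> V) : Prop :=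
  forall v : V, exists c : 'rV[k]_d, W (v - \sum_(i < d) c 0 i *: b i).

Definition finite_codim W : Prop :=
  exists d (b : 'I_d -> V), quot_spans W b.

Lemma subspaceD W x y : is_subspace W -> W x -> W y -> W (x + y).
Proof. by move=> [_ sW] Wx Wy; rewrite -(scale1r x); apply: sW. Qed.

Lemma subspaceZ W a x : is_subspace W -> W x -> W (a *: x).
Proof. by move=> [W0 sW] Wx; rewrite -(addr0 (a *: x)); apply: sW. Qed.

Lemma subspaceB W x y : is_subspace W -> W x -> W y -> W (x - y).
Proof.
by move=> sW Wx Wy; apply: subspaceD => //; rewrite -scaleN1r; apply: subspaceZ.
Qed.

Lemma subspace_sum W (I : Type) (r : seq I) (F : I -> V) :
  is_subspace W -> (forall i, W (F i)) -> W (\sum_(i <- r) F i).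
Proof.
move=> sW WF; elim/big_ind: _ => //; first by case: sW.
by move=> x y; apply: subspaceD.
Qed.

(** A relation modulo [W] with a nonzero coefficient at [i0] can be solved for [b i0], so the other
    vectors still span. *)
Lemma quot_spans_drop W d (b : 'I_d.+1 -> V) (u : 'rV[k]_d.+1) :
  is_subspace W -> quot_spans W b -> u != 0 ->
  W (\sum_(i < d.+1) u 0 i *: b i) ->
  exists b' : 'I_d -> V, quot_spans W b'.
Proof.
move=> sW bP u0 Wu; have [i0 ui0] : exists i0, u 0 i0 != 0.
  apply/existsP; apply: contraR u0; rewrite negb_exists => /forallP u0.
  by apply/eqP/rowP => i; rewrite mxE; apply/eqP; have := u0 i; rewrite negbK.
exists (b \o lift i0) => v; have [c Wc] := bP v.
pose a := c 0 i0 / u 0 i0.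
exists (\row_i (c 0 (lift i0 i) - a * u 0 (lift i0 i))).
rewrite (_ : _ - _ = v - \sum_(i < d.+1) c 0 i *: b i
                     + a *: \sum_(i < d.+1) u 0 i *: b i).
  by apply: subspaceD => //; apply: subspaceZ.
rewrite -addrA; congr (v + _); rewrite scaler_sumr addrC -opprB -sumrB.
congr (- _); rewrite [RHS](bigD1_ord i0) //= {1}scalerA /a divfK // subrr add0r.
by apply: eq_bigr => i _; rewrite mxE scalerBl scalerA.
Qed.

(** Two distinct coordinate vectors of the same element differ by a nontrivial relation modulo [W],
    and dropping a vector would contradict minimality. *)
Lemma quot_basis_of_minimal W d (b : 'I_d -> V) :
  is_subspace W -> quot_spans W b ->
  (forall d' (b' : 'I_d' -> V), quot_spans W b' -> (d <= d')%N) ->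
  quot_basis W b.
Proof.
move=> sW bP bmin v; have [c Wc] := bP v; exists c; split => // c' Wc'.
apply/eqP; rewrite -subr_eq0; apply/negPn/negP => cc'.
have Wcc' : W (\sum_(i < d) (c - c') 0 i *: b i).
  rewrite (eq_bigr (fun i => c 0 i *: b i - c' 0 i *: b i)).
    rewrite sumrB; have := subspaceB sW Wc' Wc.
    by rewrite opprB addrC -addrA addKr.
  by move=> i _; rewrite !mxE scalerBl.
case: d b bP bmin c c' cc' {Wc Wc'} Wcc' => [|d] b bP bmin c c' cc' Wcc'.
  by case/negP: cc'; apply/eqP/rowP; case.
have [b' /bmin] := quot_spans_drop sW bP cc' Wcc'.
by rewrite ltnn.
Qed.

Lemma quot_basis_exists W : is_subspace W -> finite_codim W ->
  exists d (b : 'I_d -> V), quot_basis W b /\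
  forall d' (b' : 'I_d' -> V), quot_spans W b' -> (d <= d')%N.
Proof.
move=> sW fW.
have exP : exists d, `[< exists b : 'I_d -> V, quot_spans W b >].
  by case: fW => d Wd; exists d; apply/asboolP.
case: (ex_minnP exP) => d /asboolP [b bP] dmin.
have bmin d' (b' : 'I_d' -> V) : quot_spans W b' -> (d <= d')%N.
  by move=> b'P; apply: dmin; apply/asboolP; exists b'.
by exists d, b; split => //; apply: quot_basis_of_minimal.
Qed.

Lemma quot_basis_spans W d (b : 'I_d -> V) : quot_basis W b -> quot_spans W b.
Proof. by move=> bP v; have [c [Wc _]] := bP v; exists c. Qed.

(** Express [b] through [b'] and [b'] through [b]: since coordinates in [b] are unique, the product
    of the two coefficient matrices is the identity of size [d], which forces [d <= d']. *)
Lemma quot_basis_le W d d' (b : 'I_d -> V) (b' : 'I_d' -> V) :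
  is_subspace W -> quot_basis W b -> quot_spans W b' -> (d <= d')%N.
Proof.
move=> sW bP b'P.
have /choice [c cP] v : exists c : 'rV[k]_d, W (v - \sum_(i < d) c 0 i *: b i).
  exact: quot_basis_spans.
have c_uniq v (u : 'rV[k]_d) : W (v - \sum_(i < d) u 0 i *: b i) -> u = c v.
  by have [w [_ wP]] := bP v => Wu; rewrite -(wP _ Wu) (wP _ (cP v)).
have /choice [c' c'P] v :
  exists c' : 'rV[k]_d', W (v - \sum_(i < d') c' 0 i *: b' i) by exact: b'P.
apply: (@mulmx1_min _ _ _ (\matrix_i c' (b i)) (\matrix_j c (b' j))).
apply/row_matrixP => i; rewrite row_mul rowK row1.
have -> : delta_mx 0 i = c (b i).
  apply: c_uniq; rewrite (bigD1 i) //= big1 => [|j ji].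
    by rewrite mxE !eqxx scale1r addr0 subrr; case: sW.
  by rewrite mxE (negPf ji) scale0r.
apply: c_uniq.
have -> : \sum_(i0 < d) (c' (b i) *m \matrix_j c (b' j)) 0 i0 *: b i0
   = \sum_(j < d') c' (b i) 0 j *: \sum_(i0 < d) c (b' j) 0 i0 *: b i0.
  under eq_bigr => l _ do rewrite mxE scaler_suml.
  rewrite exchange_big /=; apply: eq_bigr => j _; rewrite scaler_sumr.
  by apply: eq_bigr => l _; rewrite !mxE scalerA.
rewrite -[X in X - _](subrK (\sum_(j < d') c' (b i) 0 j *: b' j)) -addrA.
apply: subspaceD => //; rewrite -sumrB; apply: subspace_sum => // j.
by rewrite -scalerBr; apply: subspaceZ.
Qed.

Lemma quot_dimE W d (b : 'I_d -> V) :
  is_subspace W -> quot_basis W b -> quot_dim W = d.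
Proof.
move=> sW bP; rewrite /quot_dim; apply: xget_unique; first by exists b.
move=> d' [b' b'P]; apply/eqP; rewrite eqn_leq.
rewrite (quot_basis_le sW bP (quot_basis_spans b'P)) andbT.
exact: (quot_basis_le sW b'P (quot_basis_spans bP)).
Qed.

Lemma quot_dim_basis W : is_subspace W -> finite_codim W ->
  exists b : 'I_(quot_dim W) -> V, quot_basis W b.
Proof.
move=> sW /(quot_basis_exists sW) [d [b [bP _]]].
by rewrite (quot_dimE sW bP); exists b.
Qed.

Lemma finite_codimS W W' : W `<=` W' -> finite_codim W -> finite_codim W'.
Proof.
move=> WW' [d [b bP]]; exists d, b => v.
by have [c Wc] := bP v; exists c; apply: WW'.
Qed.

Lemma quot_dim_le W W' : is_subspace W -> is_subspace W' -> finite_codim W ->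
  W `<=` W' -> (quot_dim W' <= quot_dim W)%N.
Proof.
move=> sW sW' fW WW'; have [b bP] := quot_dim_basis sW fW.
have [b' b'P] := quot_dim_basis sW' (finite_codimS WW' fW).
apply: (quot_basis_le sW' b'P (b' := b)) => v.
by have [c Wc] := quot_basis_spans bP v; exists c; apply: WW'.
Qed.

Lemma quot_dim_lt W W' : is_subspace W -> is_subspace W' -> finite_codim W ->
  W `<=` W' -> ~ W' `<=` W -> (quot_dim W' < quot_dim W)%N.
Proof.
move=> sW sW' fW WW' nW'W.
have [w W'w nWw] : exists2 w, W' w & ~ W w.
  apply: contrapT => H; apply: nW'W => w W'w; apply: contrapT => nWw.
  by apply: H; exists w.
have [b bP] := quot_dim_basis sW fW.
have [b' b'P] := quot_dim_basis sW' (finite_codimS WW' fW).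
have [u Wu] := quot_basis_spans bP w.
have u0 : u != 0.
  apply/eqP => u0; apply: nWw; move: Wu; rewrite u0 big1 ?subr0 //.
  by move=> i _; rewrite mxE scale0r.
have W'u : W' (\sum_(i < quot_dim W) u 0 i *: b i).
  by rewrite -(subKr w (\sum_(i < _) _)); apply: subspaceB => //; apply: WW'.
have bP' : quot_spans W' b.
  by move=> v; have [c Wc] := quot_basis_spans bP v; exists c; apply: WW'.
move: (quot_dim W) b u u0 W'u bP' {bP Wu} => [|d] b u u0 W'u bP'.
  by case/negP: u0; apply/eqP/rowP; case.
have [b'' b''P] := quot_spans_drop sW' bP' u0 W'u.
exact: (quot_basis_le sW' b'P b''P).
Qed.

Lemma quot_dim_eq W W' : is_subspace W -> is_subspace W' -> finite_codim W ->
  W `<=` W' -> (quot_dim W <= quot_dim W')%N -> W' `<=` W.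
Proof.
move=> sW sW' fW WW' le; apply: contrapT => /(quot_dim_lt sW sW' fW WW').
by rewrite ltnNge le.
Qed.

End QuotientDimensionTheory.

(** * Ideals *)

Section IdealTheory.
Local Open Scope classical_set_scope.
Variable A : comNzRingType.
Implicit Types (I J K L S : set A) (a b x y z : A).

(** The ideals I + K and I + (a), with membership written as a congruence modulo I. *)
Definition ideal_add I K : set A := [set x | exists2 y, K y & I (x - y)].

Definition ideal_adjoin I a : set A := [set x | exists b, I (x - b * a)].

Lemma is_ideal0 I : is_ideal I -> I 0. Proof. by case. Qed.

Lemma is_idealD I x y : is_ideal I -> I x -> I y -> I (x + y).
Proof. by move=> [_ iI] Ix Iy; rewrite -(mul1r x); apply: iI. Qed.

Lemma is_idealMl I a x : is_ideal I -> I x -> I (a * x).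
Proof. by move=> [I0 iI] Ix; rewrite -(addr0 (a * x)); apply: iI. Qed.

Lemma is_idealMr I a x : is_ideal I -> I x -> I (x * a).
Proof. by rewrite mulrC; apply: is_idealMl. Qed.

Lemma is_idealB I x y : is_ideal I -> I x -> I y -> I (x - y).
Proof.
by move=> iI Ix Iy; apply: is_idealD => //; rewrite -mulN1r; apply: is_idealMl.
Qed.

Lemma is_idealBl I x y : is_ideal I -> I (x - y) -> I y -> I x.
Proof. by move=> iI Ixy Iy; rewrite -(subrK y x); apply: is_idealD. Qed.

Lemma is_ideal_sum I (T : Type) (r : seq T) (P : pred T) (F : T -> A) :
  is_ideal I -> (forall i, P i -> I (F i)) -> I (\sum_(i <- r | P i) F i).
Proof.
move=> iI IF; elim/big_ind: _ => //; first exact: is_ideal0.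
by move=> x y; apply: is_idealD.
Qed.

Lemma is_ideal_colon I a : is_ideal I -> is_ideal (colon_ideal I a).
Proof.
move=> iI; split => [|b x y]; rewrite /colon_ideal /=.
  by rewrite mul0r; apply: is_ideal0.
move=> Ix Iy; rewrite mulrDl; apply: is_idealD => //.
by rewrite -mulrA; apply: is_idealMl.
Qed.

Lemma is_ideal_add I K : is_ideal I -> is_ideal K -> is_ideal (ideal_add I K).
Proof.
move=> iI iK; split=> [|a x y [x' Kx' Ix] [y' Ky' Iy]].
  by exists 0; rewrite ?subrr; apply: is_ideal0.
exists (a * x' + y'); first by apply: is_idealD => //; apply: is_idealMl.
by rewrite opprD addrACA -mulrBr; apply: is_idealD => //; apply: is_idealMl.
Qed.

Lemma is_ideal_adjoin I a : is_ideal I -> is_ideal (ideal_adjoin I a).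
Proof.
move=> iI; split=> [|b x y [x' Ix] [y' Iy]].
  by exists 0; rewrite mul0r subrr; apply: is_ideal0.
exists (b * x' + y'); rewrite mulrDl opprD addrACA -mulrA -mulrBr.
by apply: is_idealD => //; apply: is_idealMl.
Qed.

Lemma ideal_adjoinS I a : is_ideal I -> I `<=` ideal_adjoin I a.
Proof. by move=> iI x Ix; exists 0; rewrite mul0r subr0. Qed.

Lemma ideal_adjoin_gen I a : is_ideal I -> ideal_adjoin I a a.
Proof. by move=> iI; exists 1; rewrite mul1r subrr; apply: is_ideal0. Qed.

Lemma ideal_adjoin_min I K a : is_ideal K -> I `<=` K -> K a ->
  ideal_adjoin I a `<=` K.
Proof.
move=> iK IK Ka x [b /IK Kx].
by apply: is_idealBl Kx _ => //; apply: is_idealMl.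
Qed.

Lemma ideal_addSl I K : is_ideal K -> I `<=` ideal_add I K.
Proof. by move=> iK x Ix; exists 0; rewrite ?subr0 //; apply: is_ideal0. Qed.

Lemma ideal_addSr I K : is_ideal I -> K `<=` ideal_add I K.
Proof. by move=> iI x Kx; exists x; rewrite ?subrr //; apply: is_ideal0. Qed.

Lemma ideal_add_min I K L : is_ideal L -> I `<=` L -> K `<=` L ->
  ideal_add I K `<=` L.
Proof.
by move=> iL IL KL x [y Ky /IL Lxy]; apply: is_idealBl Lxy _ => //; apply: KL.
Qed.

Lemma colon_idealS I a : is_ideal I -> I `<=` colon_ideal I a.
Proof. by move=> iI x Ix; apply: is_idealMr. Qed.

Lemma is_ideal_gen S : is_ideal (ideal_gen S).
Proof.
split=> [I iI _|a x y Sx Sy I iI SI]; first exact: is_ideal0.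
by apply: is_idealD => //; [apply: is_idealMl => //; apply: Sx|apply: Sy].
Qed.

Lemma sub_ideal_gen S : S `<=` ideal_gen S.
Proof. by move=> x Sx I _; apply. Qed.

Lemma ideal_gen_min S I : is_ideal I -> S `<=` I -> ideal_gen S `<=` I.
Proof. by move=> iI SI x; apply. Qed.

(* [1 - a] divides [1 - a ^+ N]. *)
Lemma ideal_cancel_1B I a x N : is_ideal I -> I (a ^+ N) ->
  I ((1 - a) * x) -> I x.
Proof.
move=> iI IaN Ix; rewrite -(mul1r x) -(subrK (a ^+ N) 1) mulrDl.
apply: is_idealD => //; last exact: is_idealMr.
rewrite -[X in X - _](expr1n A N) subrXX mulrAC.
exact: is_idealMr.
Qed.

End IdealTheory.

(** * Codimension of ideals and multiplication by an element *)

Section AlgebraIdeals.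
Local Open Scope classical_set_scope.
Variables (k : fieldType) (A : comAlgType k).
Implicit Types I : set A.

Lemma is_ideal_subspace I : is_ideal I -> is_subspace I.
Proof.
move=> iI; split; first exact: is_ideal0.
by move=> a x y Ix Iy; rewrite -mulr_algl; apply: (proj2 iI).
Qed.

(** Bases are glued along the exact sequence 0 -> A/(I : a) -> A/I -> A/(I + (a)) -> 0, whose first
    map is multiplication by [a]. *)
Lemma quot_basis_adjoin I a p q (b : 'I_p -> A) (c : 'I_q -> A) :
  is_ideal I ->
  quot_basis (ideal_adjoin I a) b -> quot_basis (colon_ideal I a) c ->
  quot_basis I (fun i : 'I_(p + q) =>
                  match split i with inl i1 => b i1 | inr i2 => c i2 * a end).
Proof.
move=> iI bP cP v.
have sumE (w : 'rV[k]_(p + q)) :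
    \sum_(i < p + q) w 0 i *:
      match split i with inl i1 => b i1 | inr i2 => c i2 * a end =
    \sum_(i < p) lsubmx w 0 i *: b i + (\sum_(i < q) rsubmx w 0 i *: c i) * a.
  rewrite big_split_ord /=; congr (_ + _).
    apply: eq_bigr => i _; rewrite mxE -[lshift _ _]/(unsplit (inl i)).
    by rewrite unsplitK.
  rewrite mulr_suml; apply: eq_bigr => i _; rewrite mxE.
  by rewrite -[rshift _ _]/(unsplit (inr i)) unsplitK scalerAl.
have [w1 [[x w1P] w1U]] := bP v; have [w2 [w2P w2U]] := cP x.
exists (row_mx w1 w2); split=> [|w Iw].
  rewrite sumE row_mxKl row_mxKr.
  move: w2P; rewrite /colon_ideal /= mulrBl => w2P.
  have := is_idealD iI w1P w2P; rewrite addrA subrK.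
  by rewrite -[v - _ - _]addrA opprD.
move: Iw; rewrite sumE => Iw.
have e1 : w1 = lsubmx w.
  apply: w1U; exists (\sum_(i < q) rsubmx w 0 i *: c i).
  by rewrite -addrA -opprD.
have e2 : w2 = rsubmx w.
  apply: w2U; rewrite /colon_ideal /=.
  have := is_idealB iI Iw w1P; rewrite -e1 => h.
  rewrite (_ : _ * a = v - (\sum_(i < p) w1 0 i *: b i +
     (\sum_(i < q) rsubmx w 0 i *: c i) * a) -
      (v - \sum_(i < p) w1 0 i *: b i - x * a)) //.
  by ring.
by rewrite e1 e2 hsubmxK.
Qed.

Lemma quot_dim_adjoin I a : is_ideal I -> finite_codim I ->
  quot_dim I = (quot_dim (ideal_adjoin I a) + quot_dim (colon_ideal I a))%N.
Proof.
move=> iI fI.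
have iI' := is_ideal_adjoin a iI; have iC := is_ideal_colon a iI.
have [b bP] := quot_dim_basis (is_ideal_subspace iI')
  (finite_codimS (ideal_adjoinS a iI) fI).
have [c cP] := quot_dim_basis (is_ideal_subspace iC)
  (finite_codimS (colon_idealS a iI) fI).
exact: quot_dimE (is_ideal_subspace iI) (quot_basis_adjoin iI bP cP).
Qed.

Lemma quot_dim_ideal_lt I K : is_ideal I -> is_ideal K -> finite_codim I ->
  I `<=` K -> ~ K `<=` I -> (quot_dim K < quot_dim I)%N.
Proof. by move=> iI iK; apply: quot_dim_lt; apply: is_ideal_subspace. Qed.

Lemma quot_dim_ideal_le I K : is_ideal I -> is_ideal K -> finite_codim I ->
  I `<=` K -> (quot_dim K <= quot_dim I)%N.
Proof. by move=> iI iK; apply: quot_dim_le; apply: is_ideal_subspace. Qed.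

Lemma quot_dim_ideal_eq I K : is_ideal I -> is_ideal K -> finite_codim I ->
  I `<=` K -> (quot_dim I <= quot_dim K)%N -> K `<=` I.
Proof. by move=> iI iK; apply: quot_dim_eq; apply: is_ideal_subspace. Qed.

End AlgebraIdeals.

(** * The order filtration on power series *)

Section PowerSeries.
Local Open Scope classical_set_scope.
Variables (n : nat) (k : fieldType).
Local Notation R := {mpseries k[n]}.
Implicit Types (f g h : R) (m : 'X_{1..n}) (i j : 'I_n) (J K : set R).

(** This plays the part of the power m^N of the maximal ideal m, described by coefficients instead
    of generators. *)
Definition ord_ge N : set R :=
  [set f | forall m, (mdeg m < N)%N -> mpscoef f m = 0].

Definition mpsmono (m0 : 'X_{1..n}) : R := MPSeries (fun m => (m == m0)%:R).

Lemma mpscoefD f g m : mpscoef (f + g) m = mpscoef f m + mpscoef g m.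
Proof. by []. Qed.

Lemma mpscoefB f g m : mpscoef (f - g) m = mpscoef f m - mpscoef g m.
Proof. by []. Qed.

Lemma mpscoefZ c f m : mpscoef (c *: f) m = c * mpscoef f m.
Proof. by []. Qed.

Lemma mpscoef1 m : mpscoef (1 : R) m = (m == 0%MM)%:R.
Proof. by []. Qed.

Lemma mpscoef_sum (I : Type) (r : seq I) (F : I -> R) m :
  mpscoef (\sum_(i <- r) F i) m = \sum_(i <- r) mpscoef (F i) m.
Proof. by elim/big_rec2: _ => // i x y _ <-. Qed.

Lemma mpscoefM f g m : mpscoef (f * g) m =
  \sum_(p : 'X_{1..n < (mdeg m).+1, (mdeg m).+1} | m == (p.1 + p.2)%MM)
     mpscoef f p.1 * mpscoef g p.2.
Proof. by []. Qed.

Lemma mpscoef_mulmono m0 g m : mpscoef (mpsmono m0 * g) m =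
  if (m0 <= m)%MM then mpscoef g (m - m0)%MM else 0.
Proof.
case: ifP => [le_m|nle_m].
  rewrite (@mps_mul_eq _ _ _ _ 'X_[m0] (mps_trunc (mdeg m).+1 g)).
  - rewrite mulrC; have := mcoeffMX (mps_trunc (mdeg m).+1 g) m0 (m - m0)%MM.
    by rewrite addmC submK // => ->; rewrite mcoeff_trunc // ltnS mdegB.
  - by move=> m' _; rewrite mcoeffX eq_sym.
  - by move=> m' ?; rewrite mcoeff_trunc.
rewrite mpscoefM big1 // => p /eqP mE /=.
case: eqP => [p1E|]; last by rewrite mul0r.
by case/negP: (negbT nle_m); rewrite mE -p1E lem_addr.
Qed.

Lemma mpsXE i : mpsX i = mpsmono U_(i). Proof. by []. Qed.

Lemma mpsXn i d : mpsX i ^+ d = mpsmono (U_(i) *+ d).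
Proof.
elim: d => [|d IHd].
  by rewrite expr0 mulm0n; apply: mpseriesP.
rewrite exprS IHd; apply: mpseriesP => m; rewrite mpsXE mpscoef_mulmono /=.
case: ifP => [le_m|nle_m].
  rewrite mulmS addmC; congr (nat_of_bool _)%:R; apply/eqP/eqP => [<-|->].
    by rewrite submK.
  by rewrite addmK.
case: eqP => // mE; case/negP: (negbT nle_m).
by rewrite mE mulmS lem_addr.
Qed.

Lemma mnm_le_mulU i d m : (U_(i) *+ d <= m)%MM = (d <= m i)%N.
Proof.
apply/mnm_lepP/idP => [/(_ i)|le_d j]; rewrite mulmnE mnm1E ?eqxx ?mul1n //.
by case: eqP => [<-|]; rewrite ?mul1n ?mul0n.
Qed.

(** Each monomial of [f] is assigned to the one variable picked by [sel] among those with exponent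
    at least [d], and is divided by the d-th power of that variable. *)
Lemma mps_splitXn N d f : ord_ge N f ->
  (forall m, mpscoef f m != 0 -> exists i, (d <= m i)%N) ->
  exists g : 'I_n -> R, (forall i, ord_ge (N - d) (g i)) /\
    f = \sum_i mpsX i ^+ d * g i.
Proof.
move=> fN fd.
pose sel m := [pick l | (d <= m l)%N].
pose c i m := if sel (m + U_(i) *+ d)%MM == Some i
              then mpscoef f (m + U_(i) *+ d)%MM else 0.
exists (fun i => MPSeries (c i)); split=> [i m ltm|].
  rewrite /= /c; case: ifP => // _; apply: fN.
  by rewrite mdegD mdegMn mdeg1 mul1n addnC -ltn_subRL.
apply: mpseriesP => m; rewrite mpscoef_sum.
have cE i : mpscoef (mpsX i ^+ d * MPSeries (c i)) m =
    if sel m == Some i then mpscoef f m else 0.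
  rewrite mpsXn mpscoef_mulmono mnm_le_mulU /=; case: ifP => [le_d|nle_d].
    by rewrite /c submK // mnm_le_mulU.
  case: eqP => // selE; move: selE nle_d; rewrite /sel.
  by case: pickP => // l le_l [<-]; rewrite le_l.
under eq_bigr => i _ do rewrite cE.
rewrite /sel; case: pickP => [l le_l|none].
  by rewrite (bigD1 l) //= eqxx big1 ?addr0 // => i /negPf il;
     rewrite (inj_eq Some_inj) eq_sym il.
rewrite big1 //; apply/eqP/negPn/negP => /fd [i le_i].
by have := none i; rewrite le_i.
Qed.

Lemma is_ideal_ord_ge N : is_ideal (ord_ge N).
Proof.
split=> [m _ //|a x y Nx Ny m ltm].
rewrite mpscoefD (Ny _ ltm) addr0 mpscoefM big1 // => p /eqP mE.
rewrite Nx ?mulr0 //; apply: leq_ltn_trans ltm.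
by apply: leq_trans (leq_addl (mdeg p.1) _) _; rewrite -mdegD -mE.
Qed.

Lemma ord_geM N N' f g : ord_ge N f -> ord_ge N' g -> ord_ge (N + N') (f * g).
Proof.
move=> fN gN m ltm; rewrite mpscoefM big1 // => p /eqP mE.
case: (ltnP (mdeg p.1) N) => [/fN ->|le1]; first by rewrite mul0r.
rewrite gN ?mulr0 // -(ltn_add2l (mdeg p.1)) -mdegD -mE.
by apply: leq_trans ltm _; rewrite leq_add2r.
Qed.

Lemma ord_ge1X N f : ord_ge 1 f -> ord_ge N (f ^+ N).
Proof.
move=> f1; elim: N => [|N IHN]; first by [].
by rewrite exprS -add1n; apply: ord_geM.
Qed.

Lemma ord_geS N N' : (N <= N')%N -> ord_ge N' `<=` ord_ge N.
Proof. by move=> le f fN' m ltm; apply: fN'; apply: leq_trans ltm le. Qed.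

Lemma ord_ge_mpsX i : ord_ge 1 (mpsX i).
Proof.
by move=> m; rewrite ltnS leqn0 mdeg_eq0 => /eqP -> /=; rewrite eq_sym mnm1_eq0.
Qed.

Lemma ord_ge_split N f : ord_ge N.+1 f ->
  exists2 g : 'I_n -> R, forall i, ord_ge N (g i) & f = \sum_i mpsX i * g i.
Proof.
move=> fN; have [|g [gN fE]] := @mps_splitXn _ 1 _ fN.
  move=> m fm; apply/existsP; apply: contraR fm.
  rewrite negb_exists => /forallP m0; apply/eqP/fN.
  rewrite mdegE big1 // => i _; apply/eqP.
  by have := m0 i; rewrite -leqNgt leqn0.
exists g; first by move=> i; have := gN i; rewrite subn1.
by under eq_bigr do rewrite -(expr1 (mpsX _)).
Qed.

Lemma is_ideal_max : is_ideal (@max_ideal n k).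
Proof. exact: is_ideal_gen. Qed.

Lemma max_idealE : @max_ideal n k = ord_ge 1.
Proof.
rewrite eqEsubset; split.
  apply: ideal_gen_min; first exact: is_ideal_ord_ge.
  by move=> _ [i _ <-]; apply: ord_ge_mpsX.
move=> f /ord_ge_split [g _ ->]; apply: (is_ideal_sum _ is_ideal_max) => i _.
by apply: (is_idealMr _ is_ideal_max); apply: sub_ideal_gen; exists i.
Qed.

Lemma ord_ge1_constant f : ord_ge 1 (f - (mpscoef f 0%MM)%:A).
Proof.
move=> m; rewrite ltnS leqn0 mdeg_eq0 => /eqP ->.
by rewrite mpscoefB mpscoefZ mpscoef1 eqxx mulr1 subrr.
Qed.

Lemma ord_ge1P f : ord_ge 1 f <-> mpscoef f 0%MM = 0.
Proof.
split=> [|f0 m]; first by apply; rewrite mdeg0.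
by rewrite ltnS leqn0 mdeg_eq0 => /eqP ->.
Qed.

Lemma finite_codim_ord_ge N : finite_codim (ord_ge N).
Proof.
exists #|{: 'X_{1..n < N}}|.
exists (fun e : 'I_#|_| => mpsmono (bmnm (enum_val e))) => f.
exists (\row_e mpscoef f (bmnm (enum_val e))) => m ltm.
rewrite mpscoefB mpscoef_sum; apply/eqP; rewrite subr_eq0; apply/eqP.
rewrite (bigD1 (enum_rank (BMultinom ltm))) //= big1 => [|i neq].
  by rewrite mxE enum_rankK /= eqxx mulr1 addr0.
rewrite mxE; case: eqP => [mE|_]; last by rewrite mulr0.
case/eqP: neq; apply: enum_val_inj; rewrite enum_rankK.
by apply/val_inj; rewrite /= -mE.
Qed.

(** Pigeonhole: a monomial of degree above [n * D] has some exponent at least [D], hence is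
    divisible by a power of a variable lying in [J]. *)
Lemma ord_ge_sub_radical J : is_ideal J ->
  (forall i, exists d, J (mpsX i ^+ d)) -> exists N, ord_ge N `<=` J.
Proof.
move=> iJ /choice [d Jd]; pose D := (\max_i d i).+1; exists (n * D).+1.
move=> f fN; have [|g [_ ->]] := @mps_splitXn _ D _ fN.
  move=> m fm; apply/existsP; apply: contraR fm.
  rewrite negb_exists => /forallP ltD; apply/eqP/fN.
  rewrite ltnS mdegE -[n in (_ <= n * _)%N]card_ord -sum_nat_const.
  by apply: leq_sum => i _; have := ltD i; rewrite -ltnNge => /ltnW.
apply: is_ideal_sum => // i _; apply: is_idealMr => //.
by rewrite -(subnK (_ : d i <= D)%N) ?exprD; first exact: is_idealMl;
   rewrite ltnW // ltnS leq_bigmax.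
Qed.

(* Nakayama's lemma; finite generation is replaced by the assumption that [K]
   contains all series of large order. *)
Lemma ord_ge_nakayama N s K : is_ideal K -> ord_ge N `<=` K ->
  ord_ge s `<=` ideal_add K (ord_ge s.+1) -> ord_ge s `<=` K.
Proof.
move=> iK NK sK.
(* Multiplying by the variables propagates the hypothesis to every order above [s]; chaining these
   inclusions up to order [s + N] ends inside [K]. *)
have step t : ord_ge (s + t) `<=` ideal_add K (ord_ge (s + t).+1).
  elim: t => [|t IHt]; first by rewrite addn0.
  move=> f; rewrite addnS => /ord_ge_split [g gN ->].
  apply: is_ideal_sum; first exact: is_ideal_add (is_ideal_ord_ge _).
  move=> i _; have [y yN Ky] := IHt _ (gN i).
  exists (mpsX i * y); last by rewrite -mulrBr; apply: is_idealMl.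
  by rewrite -(add1n (s + t).+1); apply: ord_geM => //; apply: ord_ge_mpsX.
have iter t : ord_ge s `<=` ideal_add K (ord_ge (s + t)).
  elim: t => [|t IHt]; first by rewrite addn0; apply: ideal_addSr.
  apply: subset_trans IHt _.
  apply: ideal_add_min; first exact: is_ideal_add (is_ideal_ord_ge _).
    by apply: ideal_addSl; apply: is_ideal_ord_ge.
  by rewrite addnS; apply: step.
move=> f /(iter N); apply: ideal_add_min => //.
by apply: subset_trans NK; apply: ord_geS; apply: leq_addl.
Qed.

(** After division by its constant term, [u] is 1 - a with a in m; then a^N lies in [J], so 1 - a
    can be cancelled modulo [J]. *)
Lemma ideal_cancel_unit N J u g : is_ideal J -> ord_ge N `<=` J ->
  ~ ord_ge 1 u -> J (u * g) -> J g.
Proof.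
move=> iJ NJ /ord_ge1P u0 Jug.
have u0' : mpscoef u 0%MM != 0 by apply/eqP.
apply: (@ideal_cancel_1B _ _ (1 - (mpscoef u 0%MM)^-1 *: u) _ N) => //.
  apply/NJ/ord_ge1X/ord_ge1P.
  by rewrite mpscoefB mpscoefZ mulVf // mpscoef1 eqxx subrr.
by rewrite subKr -scalerAl -mulr_algl; apply: is_idealMl.
Qed.

Lemma ideal_sub_ord_ge1 N J : is_ideal J -> ord_ge N `<=` J -> ~ J 1 ->
  J `<=` ord_ge 1.
Proof.
move=> iJ NJ J1 u Ju; apply: contrapT => /(ideal_cancel_unit iJ NJ) h.
by apply: J1; apply: h; rewrite mulr1.
Qed.

(** * Partial derivatives of power series *)

Lemma mpsderivD i f g : mpsderiv i (f + g) = mpsderiv i f + mpsderiv i g.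
Proof. by apply: mpseriesP => m /=; rewrite mulrnDl. Qed.

Lemma mpsderivM i f g :
  mpsderiv i (f * g) = mpsderiv i f * g + f * mpsderiv i g.
Proof.
apply: mpseriesP => m.
(* The rule is transported from polynomials. Truncation keeps degrees up to [mdeg m + 1], because a
   derivative reads coefficients one degree higher. *)
pose F := mps_trunc (mdeg m).+2 f; pose G := mps_trunc (mdeg m).+2 g.
have derivE h m' : (mdeg m' <= mdeg m)%N ->
    (mps_trunc (mdeg m).+2 h)^`M(i)@_m' = mpscoef (mpsderiv i h) m'.
  by move=> lem; rewrite mcoeff_deriv mcoeff_trunc // mdegD mdeg1 addn1 !ltnS.
rewrite mpscoefD -[LHS]/(mpscoef (mps_mul f g) (m + U_(i))%MM *+ (m i).+1).
rewrite (@mps_mul_trunc _ _ (mdeg m).+2 f g (m + U_(i))%MM); last first.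
  by rewrite mdegD mdeg1 addn1.
transitivity ((F * G)^`M(i)@_m); first by rewrite mcoeff_deriv.
rewrite mderivM mcoeffD.
rewrite (@mps_mul_eq _ _ (mpsderiv i f) g F^`M(i) G).
- rewrite (@mps_mul_eq _ _ f (mpsderiv i g) F G^`M(i)) //; last exact: derivE.
  by move=> m' lem; rewrite mcoeff_trunc // ltnS ltnW.
- exact: derivE.
- by move=> m' lem; rewrite mcoeff_trunc // ltnS ltnW.
Qed.

Lemma mpsderiv_const i (c : k) : mpsderiv i (c%:A : R) = 0.
Proof.
apply: mpseriesP => m /=.
by rewrite mnmD_eq0 mnm1_eq0 andbF mulr0 mul0rn.
Qed.

Lemma mpsderiv0 i : mpsderiv i (0 : R) = 0.
Proof. by apply: mpseriesP => m /=; rewrite mul0rn. Qed.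

Lemma mpsderiv1 i : mpsderiv i (1 : R) = 0.
Proof. by rewrite -(scale1r (1 : R)) mpsderiv_const. Qed.

Lemma mpsderivX i j : mpsderiv i (mpsX j : R) = (i == j)%:R.
Proof.
apply: mpseriesP => m /=; case: (eqVneq i j) => [<-|ij].
  rewrite -[X in _ == X]add0m eqm_add2r mpscoef1.
  by case: eqP => [->|_]; rewrite ?mnm0E ?mul0rn.
rewrite [RHS]/=; case: eqP => [/mnmP /(_ i)|]; last by rewrite mul0rn.
by rewrite mnmDE !mnm1E eqxx eq_sym (negPf ij) addn1.
Qed.

Lemma mpsderivXn i f d :
  mpsderiv i (f ^+ d.+1) = f ^+ d * mpsderiv i f *+ d.+1.
Proof.
elim: d => [|d IHd]; first by rewrite expr1 expr0 mul1r.
rewrite exprS mpsderivM IHd mulrnAr mulrA -exprS [RHS]mulrS addrC.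
by rewrite [mpsderiv i f * _]mulrC addrC.
Qed.

End PowerSeries.

(** * Jacobian ideals *)

Section Singularity.
Local Open Scope classical_set_scope.
Variables (n : nat) (k : fieldType) (char0 : [pchar k] =i pred0).
Local Notation R := {mpseries k[n]}.
Implicit Types (f g h : R) (m : 'X_{1..n}) (i j : 'I_n) (J K : set R).

Lemma natr_char0_neq0 d : d.+1%:R != 0 :> k.
Proof. by rewrite (pcharf0P k).1. Qed.

Lemma mpscoefMn f d m : mpscoef (f *+ d) m = mpscoef f m *+ d.
Proof. by elim: d => // d IHd; rewrite !mulrS mpscoefD IHd. Qed.

(** The Euler operator multiplies the homogeneous part of degree d by d. *)
Lemma mpscoef_euler f m :
  mpscoef (\sum_i mpsX i * mpsderiv i f) m = mpscoef f m *+ mdeg m.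
Proof.
rewrite mpscoef_sum mdegE -sumrMnr; apply: eq_bigr => i _.
rewrite mpsXE mpscoef_mulmono -[U_(i)%MM]mulm1n mnm_le_mulU.
rewrite /=; case: (posnP (m i)) => [->//|mi_gt0].
by rewrite mulm1n submK ?mnmBE ?mnm1E ?eqxx ?subn1 ?prednK //
           -[U_(i)%MM]mulm1n mnm_le_mulU.
Qed.

Lemma is_ideal_add_ord_ge J N : is_ideal J -> is_ideal (ideal_add J (ord_ge N)).
Proof. by move=> iJ; apply: is_ideal_add iJ (is_ideal_ord_ge _ _ N). Qed.

Lemma is_ideal_jacobian f : is_ideal (jacobian_ideal f).
Proof. exact: is_ideal_gen. Qed.

Lemma jacobian_ideal_deriv f i : jacobian_ideal f (mpsderiv i f).
Proof. by apply: sub_ideal_gen; exists i. Qed.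

(* Euler's identity for the quadratic part of [f]. *)
Lemma jacobian_add_ord_ge3 f :
  ord_ge 1 f -> (forall i, ord_ge 1 (mpsderiv i f)) ->
  ideal_add (jacobian_ideal f) (ord_ge 3) f.
Proof.
move=> f1 df1; have iJ := is_ideal_jacobian f.
exists (f - 2%:R^-1 *: \sum_i mpsX i * mpsderiv i f); last first.
  rewrite subKr -mulr_algl; apply: (is_idealMl _ iJ).
  apply: (is_ideal_sum _ iJ) => i _.
  by apply: (is_idealMl _ iJ); apply: jacobian_ideal_deriv.
move=> m lt_m3; rewrite mpscoefB mpscoefZ mpscoef_euler.
case deg: (mdeg m) lt_m3 => [|[|[|d]]] // _.
- by rewrite f1 ?deg // mul0rn mulr0 subr0.
- have /mdeg1P [i /eqP mE] : mdeg m == 1%N by rewrite deg.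
  have := df1 i 0%MM; rewrite mdeg0 /= add0m mnm0E mulr1n => /(_ isT) fU.
  by rewrite mE fU mul0rn mulr0 subr0.
- by rewrite -(mulr_natl (mpscoef f m) 2) mulKf ?subrr // natr_char0_neq0.
Qed.

(* Singularities of type A_k are quasihomogeneous.  With t = x_j there are series
   p_i in t alone such that x_i - t p_i is in J.  The vector field
   xi = sum_i d(t p_i)/dt d/dx_i kills every x_i - t p_i and maps t to 1, so
   f = r t^l modulo the x_i - t p_i with r a unit would give
   t^(l-1) in J + (xi f) = J, against the minimality of the power of t in J. *)
Lemma jacobian_of_corank1 f j N :
  ord_ge 1 f -> ord_ge N `<=` jacobian_ideal f -> ~ jacobian_ideal f 1 ->
  ord_ge 1 `<=`
    ideal_adjoin (ideal_add (jacobian_ideal f) (ord_ge 2)) (mpsX j) ->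
  jacobian_ideal f f.
Proof.
set J := jacobian_ideal f; set t := mpsX j => f1 NJ J1 corank1.
have iJ : is_ideal J := is_ideal_jacobian f.
have J_m : J `<=` ord_ge 1 := ideal_sub_ord_ge1 iJ NJ J1.
have t1 : ord_ge 1 t by apply: ord_ge_mpsX.
have iJt : is_ideal (ideal_adjoin J t) by apply: is_ideal_adjoin.
have mJt : ord_ge 1 `<=` ideal_adjoin J t.
  apply: (ord_ge_nakayama (N := N) iJt).
    by apply: subset_trans NJ _; apply: ideal_adjoinS.
  apply: subset_trans corank1 _; apply: ideal_adjoin_min.
  - exact: is_ideal_add_ord_ge.
  - apply: ideal_add_min; first exact: is_ideal_add_ord_ge.
      apply: subset_trans (ideal_adjoinS t iJ) _.
      exact/ideal_addSl/is_ideal_ord_ge.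
    exact: ideal_addSr.
  - by apply: ideal_addSl; [apply: is_ideal_ord_ge|apply: ideal_adjoin_gen].
(* In characteristic zero this says that q is a series in t alone. *)
pose only_t (q : R) := forall i, i != j -> mpsderiv i q = 0.
have expand_pow d r : exists2 q, only_t q & ideal_adjoin J (t ^+ d) (r - q).
  elim: d r => [|d IHd] r.
    exists 0; first by move=> i _; rewrite mpsderiv0.
    by exists r; rewrite subr0 mulr1 subrr; apply: is_ideal0.
  have [b Jb] := mJt _ (ord_ge1_constant r).
  have [q qt [c Jc]] := IHd b.
  exists ((mpscoef r 0%MM)%:A + t * q).
    move=> i ij; rewrite mpsderivD mpsderiv_const mpsderivM qt //.
    by rewrite mpsderivX (negPf ij) mul0r mulr0 !addr0.
  exists c; rewrite exprS.
  have -> : r - ((mpscoef r 0%MM)%:A + t * q) - c * (t * t ^+ d) =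
      (r - (mpscoef r 0%MM)%:A - b * t) + t * (b - q - c * t ^+ d) by ring.
  by apply: (is_idealD iJ) => //; apply: (is_idealMl _ iJ).
(* Since t^N lies in J, N successive divisions by t are enough. *)
have expand r : exists2 q, only_t q & J (r - q).
  have [q qt [c Jc]] := expand_pow N r; exists q => //.
  by apply: (is_idealBl iJ Jc); apply: (is_idealMl _ iJ); apply: NJ; apply: ord_ge1X.
(* The choice p_j = 1 makes x_j - t p_j vanish, so that [xi] maps t to 1. *)
have /choice [p pP] i :
    exists p, [/\ only_t p, J (mpsX i - t * p) & i = j -> p = 1].
  case: (eqVneq i j) => [->|ij].
    exists 1; split=> // [l _|]; last by rewrite mulr1 subrr; apply: is_ideal0.
    by rewrite mpsderiv1.
  have [b Jb] := mJt _ (ord_ge_mpsX k i); have [q qt Jq] := expand b.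
  exists q; split=> //; last by move/eqP: ij.
  have -> : mpsX i - t * q = (mpsX i - b * t) + t * (b - q) by ring.
  by apply: (is_idealD iJ) => //; apply: (is_idealMl _ iJ).
pose xi r := \sum_i mpsderiv j (t * p i) * mpsderiv i r.
have xiD r s : xi (r + s) = xi r + xi s.
  by rewrite /xi -big_split; apply: eq_bigr => i _; rewrite mpsderivD mulrDr.
have xiM r s : xi (r * s) = xi r * s + r * xi s.
  rewrite /xi mulr_suml mulr_sumr -big_split; apply: eq_bigr => i _.
  by rewrite (mpsderivM i r s) mulrDr mulrA mulrCA.
have pj : p j = 1 by have [_ _ ->] := pP j.
have xiE q : only_t q -> xi q = mpsderiv j q.
  move=> qt; rewrite /xi (bigD1 j) //= big1 => [|i ij].
    by rewrite pj mulr1 mpsderivX eqxx mul1r addr0.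
  by rewrite qt ?mulr0.
have xiX i : xi (mpsX i) = mpsderiv j (t * p i).
  rewrite /xi (bigD1 i) //= big1 => [|l li].
    by rewrite mpsderivX eqxx mulr1 addr0.
  by rewrite mpsderivX (negPf li) mulr0.
have tpt i : only_t (t * p i).
  have [pt _ _] := pP i; move=> l lj.
  by rewrite mpsderivM pt // mpsderivX (negPf lj) mul0r mulr0 addr0.
(* By the Leibniz rule this is an ideal. It contains all x_i - t p_i and stands in for the ideal
   they generate, with the advantage that [xi] maps it into J. *)
pose K := [set r | J r /\ J (xi r)].
have iK : is_ideal K.
  split=> [|a x y [Jx Jxx] [Jy Jxy]].
    split; first exact: is_ideal0.
    by rewrite xiE ?mpsderiv0; [apply: is_ideal0|move=> i _; rewrite mpsderiv0].
  split; first by apply: (is_idealD iJ) => //; apply: (is_idealMl _ iJ).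
  rewrite xiD xiM; apply: (is_idealD iJ) => //.
  by apply: (is_idealD iJ) => //; apply: (is_idealMl _ iJ).
have Ky i : K (mpsX i - t * p i).
  have [_ Jy _] := pP i; split=> //.
  have -> : xi (mpsX i - t * p i) = xi (mpsX i) - xi (t * p i).
    by apply/eqP; rewrite eq_sym subr_eq -xiD subrK.
  by rewrite xiX (xiE _ (tpt i)) subrr; apply: is_ideal0.
have mKt : ord_ge 1 `<=` ideal_adjoin K t.
  move=> r /ord_ge_split [g _ ->].
  have iKt := is_ideal_adjoin t iK; apply: (is_ideal_sum _ iKt) => i _.
  apply: (is_idealMr _ iKt).
  by exists (p i); rewrite mulrC.
have Jxif : J (xi f).
  apply: (is_ideal_sum _ iJ) => i _; apply: (is_idealMl _ iJ).
  exact: jacobian_ideal_deriv.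
have exP : exists d, `[< J (t ^+ d) >].
  by exists N; apply/asboolP; apply: NJ; apply: ord_ge1X.
case: (ex_minnP exP) => -[|d] /asboolP Jtd dmin; first by rewrite expr0 in Jtd.
have xit l : xi (t ^+ l.+1) = t ^+ l *+ l.+1.
  rewrite xiE => [|i ij]; rewrite mpsderivXn mpsderivX ?eqxx ?mulr1 //.
  by rewrite (negPf ij) mulr0 mul0rn.
have approx l : (l <= d)%N -> ideal_adjoin K (t ^+ l.+1) f.
  elim: l => [|l IHl] le_ld; first by rewrite expr1; apply: mKt.
  have [r Kr] := IHl (ltnW le_ld).
  (* If r lies in m, it is a multiple of t modulo K and the order in t goes up by one. *)
  case: (pselect (ord_ge 1 r)) => [/mKt [b Kb]|r1].
    exists b.
    have -> : f - b * t ^+ l.+2 = (f - r * t ^+ l.+1) + (r - b * t) * t ^+ l.+1.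
      by rewrite !exprS; ring.
    by apply: (is_idealD iK) => //; apply: (is_idealMr _ iK).
  have Jxir : J (xi (r * t ^+ l.+1)).
    rewrite -[xi _](addKr (xi (f - r * t ^+ l.+1))) -xiD subrK addrC.
    by apply: (is_idealB iJ) => //; case: Kr.
  suff : (d < l)%N by rewrite ltnNge (ltnW le_ld).
  apply: dmin; apply/asboolP.
  (* xi(r t^(l+1)) = t^l (xi(r) t + (l+1) r), and the second factor is a unit in characteristic
     zero, so t^l would lie in J. *)
  apply: (ideal_cancel_unit iJ NJ (u := xi r * t + r *+ l.+1)).
    move=> /ord_ge1P u1; apply: r1; apply/ord_ge1P; move: u1.
    rewrite mpscoefD mpscoefMn (proj1 (ord_ge1P _)); last first.
      by apply: is_idealMl t1; apply: is_ideal_ord_ge.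
    rewrite add0r -mulr_natr => /eqP.
    by rewrite mulf_eq0 (negPf (natr_char0_neq0 _)) orbF => /eqP.
  move: Jxir; rewrite xiM xit exprS => Jxir.
  by rewrite mulrDl -mulrA mulrnAl -mulrnAr.
have [r [Jr _]] := approx d (leqnn d).
by apply: (is_idealBl iJ Jr); apply: (is_idealMl _ iJ).
Qed.


(** * Lower bounds on codimensions *)

Lemma quot_dim_adjoin_ge2 f K N : is_ideal K -> ord_ge N `<=` K ->
  ord_ge 1 f -> ideal_add K (ord_ge 2) f -> ~ K f ->
  (2 <= quot_dim (ideal_adjoin K f))%N.
Proof.
move=> iK NK f1 f2 nKf; have iKf := is_ideal_adjoin f iK.
have K1 : ~ K 1.
  by move=> K1; apply: nKf; rewrite -(mulr1 f); apply: (is_idealMl _ iK).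
have Km := ideal_sub_ord_ge1 iK NK K1.
have i1 := @is_ideal_ord_ge n k 1.
have lt1 : (quot_dim (ord_ge 1 : set R) < quot_dim (ideal_adjoin K f))%N.
  apply: quot_dim_ideal_lt => //.
  - apply: finite_codimS (finite_codim_ord_ge _ _ N).
    exact: subset_trans NK (ideal_adjoinS _ _).
  - exact: ideal_adjoin_min.
  (* The inclusion K + (f) in m is strict: otherwise m lies in K + m^2, because f does, and Nakayama
     puts m, hence f, into K. *)
  - move=> m_sub; apply: nKf; apply: (ord_ge_nakayama iK NK (s := 1)) f1.
    apply: subset_trans m_sub _; apply: ideal_adjoin_min => //.
      exact: is_ideal_add_ord_ge.
    by apply: ideal_addSl; apply: is_ideal_ord_ge.
have lt0 : (quot_dim [set: R] < quot_dim (ord_ge 1 : set R))%N.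
  apply: quot_dim_ideal_lt => //; first exact: finite_codim_ord_ge.
  by move=> /(_ 1 I) /ord_ge1P /eqP; rewrite mpscoef1 eqxx oner_eq0.
exact: leq_ltn_trans (leq_ltn_trans (leq0n _) lt0) lt1.
Qed.

Lemma colon_idealMexp J f d :
  colon_ideal (colon_ideal J (f ^+ d)) f = colon_ideal J (f ^+ d.+1).
Proof. by apply/seteqP; split=> x; rewrite /colon_ideal /= exprS mulrA. Qed.

(** In the chain J : f, J : f^2, ..., J : f^(d+1) each of the d steps lowers the codimension by at
    least 2, and the last ideal is still proper, which contributes the final 1. *)
Lemma quot_dim_colon_exp f J N d : is_ideal J -> ord_ge N `<=` J ->
  ord_ge 1 f -> ideal_add J (ord_ge 2) f -> ~ J (f ^+ d.+1) ->
  (2 * d + 1 <= quot_dim (colon_ideal J f))%N.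
Proof.
move=> iJ NJ f1 f2 nJfd.
have iC e := @is_ideal_colon _ J (f ^+ e) iJ.
have NC e : ord_ge N `<=` colon_ideal J (f ^+ e).
  exact: subset_trans NJ (colon_idealS _ iJ).
have fC e : finite_codim (colon_ideal J (f ^+ e)).
  exact: finite_codimS (NC e) (finite_codim_ord_ge _ _ N).
have pos : (0 < quot_dim (colon_ideal J (f ^+ d.+1)))%N.
  apply: leq_ltn_trans (leq0n (quot_dim [set: R])) _.
  apply: quot_dim_ideal_lt => // /(_ 1 I); rewrite /colon_ideal /= mul1r.
  exact: nJfd.
have step e : ~ J (f ^+ e.+1) ->
    (2 + quot_dim (colon_ideal J (f ^+ e.+1))
       <= quot_dim (colon_ideal J (f ^+ e)))%N.
  move=> nJfe; rewrite (quot_dim_adjoin f (iC e) (fC e)) colon_idealMexp.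
  rewrite leq_add2r; apply: (quot_dim_adjoin_ge2 (iC e) (NC e) f1); last first.
    by rewrite /colon_ideal /= -exprS.
  apply: ideal_add_min f2; first exact: is_ideal_add_ord_ge.
    apply: subset_trans (colon_idealS _ iJ) _.
    by apply: ideal_addSl; apply: is_ideal_ord_ge.
  exact: ideal_addSr.
have down e : (e <= d)%N -> ~ J (f ^+ e.+1).
  move=> le_ed Jfe; apply: nJfd; rewrite -(subnK le_ed) -addnS exprD.
  exact: (is_idealMl _ iJ).
rewrite -[f in colon_ideal J f]expr1.
suff chain e : (e <= d)%N ->
    (2 * e + quot_dim (colon_ideal J (f ^+ e.+1))
       <= quot_dim (colon_ideal J (f ^+ 1)))%N.
  by apply: leq_trans (chain d (leqnn d)); rewrite leq_add2l.
elim: e => [|e IHe] le_ed; first by rewrite muln0.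
apply: leq_trans (IHe (ltnW le_ed)).
by rewrite mulnS [(2 + _)%N]addnC -addnA leq_add2l; apply/step/down.
Qed.

Lemma colon_not_sub_adjoin f N (J := jacobian_ideal f) :
  ord_ge 1 f -> (forall i, ord_ge 1 (mpsderiv i f)) ->
  ord_ge N `<=` J -> ~ J 1 -> ~ J f ->
  (quot_dim (ideal_adjoin J f) <= 4)%N ->
  ~ colon_ideal J f `<=` ideal_adjoin J f.
Proof.
move=> f1 df1 NJ J1 nJf tau4 CJ.
have iJ : is_ideal J := is_ideal_jacobian f.
have f3 : ideal_add J (ord_ge 3) f := jacobian_add_ord_ge3 f1 df1.
have iM d : is_ideal (ord_ge d : set R) := is_ideal_ord_ge n k d.
have iJM d : is_ideal (ideal_add J (ord_ge d)) := is_ideal_add_ord_ge d iJ.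
have NJM d : ord_ge N `<=` ideal_add J (ord_ge d).
  exact: subset_trans NJ (ideal_addSl (iM d)).
have fin K : ord_ge N `<=` K -> finite_codim K.
  by move=> NK; apply: finite_codimS NK (finite_codim_ord_ge _ _ N).
have JM_le d e : (d <= e)%N ->
    ideal_add J (ord_ge e) `<=` ideal_add J (ord_ge d).
  move=> le_de; apply: ideal_add_min => //; first exact: ideal_addSl.
  apply: subset_trans (ord_geS le_de) _; exact: ideal_addSr.
have J_m : J `<=` ord_ge 1 := ideal_sub_ord_ge1 iJ NJ J1.
have IJM3 : ideal_adjoin J f `<=` ideal_add J (ord_ge 3).
  by apply: (ideal_adjoin_min (iJM 3%N)) f3; apply: ideal_addSl.
have nM1 : ~ ord_ge 1 `<=` ideal_add J (ord_ge 2).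
  by move=> m_sub; apply: nJf; apply: (ord_ge_nakayama iJ NJ m_sub).
have [j nj] : exists j, ~ ideal_add J (ord_ge 2) (mpsX j).
  apply: contrapT => noj; apply: nM1 => r /ord_ge_split [g _ ->].
  apply: (is_ideal_sum _ (iJM 2%N)) => i _; apply: (is_idealMr _ (iJM 2%N)).
  by apply: contrapT => ni; apply: noj; exists i.
pose P := ideal_adjoin (ideal_add J (ord_ge 2)) (mpsX j).
have iP : is_ideal P by apply: is_ideal_adjoin.
have NP : ord_ge N `<=` P.
  by apply: subset_trans (NJM 2%N) _; apply: ideal_adjoinS.
(* Together with the choice of x_j this says that m/(J + m^2) has dimension at least 2. *)
have nP : ~ ord_ge 1 `<=` P.
  by move=> mP; apply: nJf; apply: jacobian_of_corank1 f1 NJ J1 mP.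
have dim3 : (3 <= quot_dim (ideal_add J (ord_ge 2)))%N.
  have lt2 : (quot_dim P < quot_dim (ideal_add J (ord_ge 2)))%N.
    apply: quot_dim_ideal_lt => //; [exact/fin/NJM|exact: ideal_adjoinS|].
    by move=> /(_ (mpsX j)) h; apply/nj/h/ideal_adjoin_gen.
  have lt1 : (quot_dim (ord_ge 1 : set R) < quot_dim P)%N.
    apply: quot_dim_ideal_lt => //; first exact: fin.
    apply: ideal_adjoin_min => //; last exact: ord_ge_mpsX.
    by apply: ideal_add_min => //; apply: ord_geS.
  have lt0 : (quot_dim [set: R] < quot_dim (ord_ge 1 : set R))%N.
    apply: quot_dim_ideal_lt => //; first exact: finite_codim_ord_ge.
    by move=> /(_ 1 I) /ord_ge1P /eqP; rewrite mpscoef1 eqxx oner_eq0.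
  by lia.
have JM3_dim : (quot_dim (ideal_add J (ord_ge 3)) <= 4)%N.
  apply: leq_trans tau4; apply: quot_dim_ideal_le => //.
    exact: is_ideal_adjoin.
  by apply: fin; apply: subset_trans NJ _; apply: ideal_adjoinS.
(* Otherwise Nakayama gives that m^2 lies in J, and f lies in J + m^3. *)
have nM2 : ~ ord_ge 2 `<=` ideal_add J (ord_ge 3).
  move=> M2_sub; apply: nJf.
  have [y y3 Jfy] := f3.
  apply: (is_idealBl iJ Jfy); apply: (ord_ge_nakayama iJ NJ M2_sub).
  exact: (ord_geS (N := 2)) y3.
(* polarization: [2xy = (x + y)^2 - x^2 - y^2] *)
have [l l1 nl] : exists2 l : R, ord_ge 1 l & ~ ideal_add J (ord_ge 3) (l ^+ 2).
  apply: contrapT => nol; apply: nM2.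
  have sq l : ord_ge 1 l -> ideal_add J (ord_ge 3) (l ^+ 2).
    by move=> l1; apply: contrapT => nl; apply: nol; exists l.
  move=> r /ord_ge_split [g g1 ->]; apply: (is_ideal_sum _ (iJM 3%N)) => i _.
  have x1 : ord_ge 1 (mpsX i : R) := ord_ge_mpsX k i.
  have -> : mpsX i * g i = (2%:R^-1 : k)%:A *
      ((mpsX i + g i) ^+ 2 - mpsX i ^+ 2 - g i ^+ 2).
    rewrite (_ : _ - _ - _ = (2%:R : k) *: (mpsX i * g i)).
      by rewrite mulr_algl scalerA mulVf ?scale1r // natr_char0_neq0.
    by rewrite scaler_nat; ring.
  apply: (is_idealMl _ (iJM 3%N)); apply: (is_idealB (iJM 3%N)); last exact: sq.
  apply: (is_idealB (iJM 3%N)); last exact: sq.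
  by apply: sq; apply: (is_idealD (iM 1%N)).
have iJl d : is_ideal (ideal_adjoin J (l ^+ d)) by apply: is_ideal_adjoin.
(* [Q] has codimension at most 3, as l^2 is not in J + m^3, and it lies in J + m^2, whose
   codimension is at least 3. So the two agree, and Nakayama removes m^3 from [Q]. *)
have M2l : ord_ge 2 `<=` ideal_adjoin J (l ^+ 2).
  pose Q := ideal_adjoin (ideal_add J (ord_ge 3)) (l ^+ 2).
  have iQ : is_ideal Q by apply: is_ideal_adjoin.
  have lM2 : ord_ge 2 (l ^+ 2) by apply: ord_ge1X.
  have lt3 : (quot_dim Q < quot_dim (ideal_add J (ord_ge 3)))%N.
    apply: quot_dim_ideal_lt => //; [exact/fin/NJM|exact: ideal_adjoinS|].
    by move=> /(_ (l ^+ 2)) h; apply/nl/h/ideal_adjoin_gen.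
  have JM2Q : ideal_add J (ord_ge 2) `<=` Q.
    apply: quot_dim_ideal_eq => //.
    - by apply: fin; apply: subset_trans (NJM 3%N) _; apply: ideal_adjoinS.
    - apply: ideal_adjoin_min => //; first exact: JM_le.
      exact: ideal_addSr.
    - by apply: leq_trans dim3; rewrite -ltnS; apply: leq_trans lt3 JM3_dim.
  apply: (ord_ge_nakayama (N := N) (iJl 2%N)).
    by apply: subset_trans NJ _; apply: ideal_adjoinS.
  have iJlM := is_ideal_add_ord_ge 3 (iJl 2%N).
  apply: subset_trans (ideal_addSr iJ) _; apply: subset_trans JM2Q _.
  apply: ideal_adjoin_min => //.
    apply: ideal_add_min => //; last exact: ideal_addSr.
    by apply: subset_trans (ideal_adjoinS (l ^+ 2) iJ) _; apply: ideal_addSl.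
  by apply: ideal_addSl => //; apply: ideal_adjoin_gen.
have Xl i : exists c, J (mpsX i * l - c * l ^+ 2).
  by apply: M2l; apply: (ord_geM (N := 1) (N' := 1)) => //; apply: ord_ge_mpsX.
(* Modulo J, x_i g_i = b x_i l^2 = b c l^3. *)
have M3l : ord_ge 3 `<=` ideal_adjoin J (l ^+ 3).
  move=> r /ord_ge_split [g g2 ->]; apply: (is_ideal_sum _ (iJl 3%N)) => i _.
  have [b Jb] := M2l _ (g2 i); have [c Jc] := Xl i; exists (b * c).
  have -> : mpsX i * g i - b * c * l ^+ 3 =
    mpsX i * (g i - b * l ^+ 2) + b * l * (mpsX i * l - c * l ^+ 2) by ring.
  by apply: (is_idealD iJ); apply: (is_idealMl _ iJ).
have [b Jb] : ideal_adjoin J (l ^+ 3) f.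
  by apply: ideal_add_min f3 => //; apply: ideal_adjoinS.
(* As f = b l^3 modulo J, the product (x_i - c l) f is b l^2 (x_i l - c l^2) = 0 modulo J. Hence x_i
   - c l lies in J : f, and by [CJ] in J + m^2. *)
have M1l : ord_ge 1 `<=` ideal_adjoin (ideal_add J (ord_ge 2)) l.
  move=> r /ord_ge_split [g _ ->].
  have iA := is_ideal_adjoin l (iJM 2%N); apply: (is_ideal_sum _ iA) => i _.
  apply: (is_idealMr _ iA); have [c Jc] := Xl i; exists c.
  apply: (JM_le 2%N 3%N) => //; apply: IJM3; apply: CJ; rewrite /colon_ideal /=.
  have -> : (mpsX i - c * l) * f = (mpsX i - c * l) * (f - b * l ^+ 3) +
     b * l ^+ 2 * (mpsX i * l - c * l ^+ 2) by ring.
  by apply: (is_idealD iJ); apply: (is_idealMl _ iJ).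
have [c Kc] := M1l _ (ord_ge_mpsX k j).
(* With [c] in m, x_j would lie in J + m^2. So [c] is a unit, [l] lies in [P], and then so does all
   of m. *)
have c1 : ~ ord_ge 1 c.
  move=> c1; apply: nj; apply: (is_idealBl (iJM 2%N) Kc).
  apply: ideal_addSr => //.
  exact: (ord_geM (N := 1) (N' := 1)).
have Pl : P l.
  apply: (ideal_cancel_unit iP NP c1); exists 1; rewrite mul1r.
  have -> : c * l - mpsX j = (-1) * (mpsX j - c * l) by ring.
  exact: (is_idealMl _ (iJM 2%N)).
apply: nP; apply: subset_trans M1l _; apply: ideal_adjoin_min => //.
exact: ideal_adjoinS.
Qed.

(** * Consequences of the isolated singularity *)

Lemma tjurina_idealE f : tjurina_ideal f = ideal_adjoin (jacobian_ideal f) f.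
Proof.
have iJ := is_ideal_jacobian f; apply/seteqP; split.
  apply: ideal_gen_min; first exact: is_ideal_adjoin.
  by move=> x [->|Jx]; [apply: ideal_adjoin_gen|apply: ideal_adjoinS].
apply: ideal_adjoin_min; first exact: is_ideal_gen.
  by move=> x Jx; apply: sub_ideal_gen; right.
by apply: sub_ideal_gen; left.
Qed.

Lemma jacobian_ideal_cofinite f : isolated_singularity f ->
  exists N, ord_ge N `<=` jacobian_ideal f.
Proof.
case=> _ _ [_ radJ] _; apply: ord_ge_sub_radical; first exact: is_ideal_jacobian.
move=> i; suff : ideal_radical (jacobian_ideal f) (mpsX i) by [].
by rewrite radJ max_idealE; apply: ord_ge_mpsX.
Qed.

(** The radical of J is m, which contains f. So some power of f lies in J, and the minimum is
    attained instead of taking its default value. *)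
Lemma bs_exponentP f : isolated_singularity f ->
  jacobian_ideal f (f ^+ bs_exponent f) /\
  forall d, jacobian_ideal f (f ^+ d) -> (bs_exponent f <= d)%N.
Proof.
case=> f_m _ [_ radJ] _; rewrite /bs_exponent /nat_min.
set S := (X in xget _ X).
suff exS : exists d, S d by have [] := xgetPex 0%N exS.
have exP : exists d, `[< jacobian_ideal f (f ^+ d) >].
  suff [d Jfd] : ideal_radical (jacobian_ideal f) f by exists d; apply/asboolP.
  by rewrite radJ.
case: (ex_minnP exP) => d /asboolP Jfd dmin; exists d; split=> // e Jfe.
by apply: dmin; apply/asboolP.
Qed.

End Singularity.

(** * Deduction of the four statements from mu - tau >= 2 e - 3 *)

Theorem corollary3p5 (n : nat) (hn : (2 <= n)%N) (k : fieldType)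
    (char0 : [pchar k] =i pred0) (f : {mpseries k[n]})
    (fsing : isolated_singularity f) (fnqh : ~ quasihomogeneous f) :
  let mu := milnor_number f in
  let tau := tjurina_number f in
  let e := bs_exponent f in
  let beta := mt_ratio f in
  let d : int := mu%:Z - tau%:Z in
  [/\ d <= 2 -> e = 2%N,
      d <= e%:Z - 1 -> e = 2%N,
      d = 3 -> (e <= 3)%N /\ ((beta, tau) = (1, 2)%N \/ beta = 0%N)
    & d = 4 ->
        (e <= 3)%N /\ [\/ (beta, e, tau) = (1, 3, 3)%N,
                          (beta, e, tau) = (1, 3, 2)%N
                        | beta = 0%N]].
Proof.
move=> mu tau e beta d.
have [N NJ] := jacobian_ideal_cofinite fsing.
have [f_m df_m [[iJ J1 _] _] _] := fsing.
have f1 : ord_ge 1 f by rewrite -max_idealE.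
have df1 i : ord_ge 1 (mpsderiv i f) by rewrite -max_idealE; apply: df_m.
have f3 := jacobian_add_ord_ge3 char0 f1 df1.
have f2 : ideal_add (jacobian_ideal f) (ord_ge 2) f.
  by have [y y3 Jfy] := f3; exists y => //; apply: (ord_geS (N := 2)) y3.
have fin : finite_codim (jacobian_ideal f).
  exact: finite_codimS NJ (finite_codim_ord_ge _ _ N).
have muE : mu = (tau + quot_dim (colon_ideal (jacobian_ideal f) f))%N.
  by rewrite /mu /tau /tjurina_number tjurina_idealE; apply: quot_dim_adjoin.
have [Jfe emin] := bs_exponentP fsing.
have e2 : (2 <= e)%N.
  rewrite ltnNge; apply/negP => e1; move: Jfe; rewrite -/e.
  case: e e1 => [|[|//]] _; first by rewrite expr0.
  by rewrite expr1.
(* By minimality of e, f^(e-1) is not in J, so the chain of colon ideals has e - 2 steps. *)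
have d_ge : (2 * (e - 2) + 1 <= quot_dim (colon_ideal (jacobian_ideal f) f))%N.
  apply: (quot_dim_colon_exp iJ NJ f1 f2) => /emin; rewrite -/e.
  by rewrite -subSn // subSS subn1 leqNgt prednK ?ltnS ?leqnn // ltnW.
have beta0 : (quot_dim (colon_ideal (jacobian_ideal f) f) <= 4)%N -> beta = 0%N.
  move=> dim4; rewrite /beta /mt_ratio /nat_max.
  (* If there is no maximum, the value is 0 by default. A positive maximum i + 1 gives J : f in J :
     f^(i+1), hence in J + (f), which bounds tau by mu - tau. *)
  case: xgetP => // i _ [colon_sub _]; case: i colon_sub => // i colon_sub.
  have CJ : (colon_ideal (jacobian_ideal f) f
             `<=` ideal_adjoin (jacobian_ideal f) f)%classic.
    rewrite -tjurina_idealE => x Jxf; apply: colon_sub; apply: sub_ideal_gen.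
    left; rewrite /colon_ideal /= exprS mulrA.
    exact: (is_idealMr _ iJ).
  case: (colon_not_sub_adjoin char0 f1 df1 NJ J1 fnqh _ CJ).
  apply: leq_trans dim4; apply: quot_dim_ideal_le => //.
  - exact: is_ideal_colon.
  - exact: is_ideal_adjoin.
  - by apply: finite_codimS fin; apply: colon_idealS.
move: muE beta0 d_ge; set c := quot_dim _ => muE beta0 d_ge.
have dE : d = c%:Z by rewrite /d muE PoszD addrC addKr.
(* With c = mu - tau >= 2 e - 3 and e >= 2: c <= 2 and c <= e - 1 each force e = 2, while c <= 4
   gives e <= 3. *)
rewrite dE; split.
- by move=> c2; lia.
- by move=> ce; lia.
- by move=> c3; split; [lia|right; apply: beta0; lia].
- by move=> c4; split; [lia|apply: Or33; apply: beta0; lia].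
Qed.
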